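(* There is a satisfiable HyperLTL sentence that is not satisfied by any set of ultimately periodic traces.
   Context: Fix a finite set $AP$ of atomic propositions. A trace over $AP$ is a map $t:\mathbb{N}\to 2^{AP}$. A trace $t$ is ultimately periodic if $t=t_0\cdot t_1^\omega$ for some nonempty finite words $t_0,t_1$ over $2^{AP}$, i.e., there are $s,p>0$ with $t(n)=t(n+p)$ for all $n\ge s$; a set of traces is ultimately periodic if all its traces are. HyperLTL formulas are given by the grammar $\varphi ::= \exists \pi.\ \varphi \mid \forall \pi.\ \varphi \mid \psi$ and $\psi ::= a_\pi \mid \neg\psi \mid \psi\vee\psi \mid \mathbf{X}\psi \mid \psi\,\mathbf{U}\,\psi$, where $a\in AP$ and $\pi$ ranges over a countable set of trace variables. For a set $T$ of traces and a trace assignment $\Pi$ (a partial map from trace variables to traces), with $\Pi[j]$ denoting the assignment mapping each $\pi$ in the domain of $\Pi$ to the suffix $\Pi(\pi)(j)\Pi(\pi)(j+1)\cdots$: $(T,\Pi)\models a_\pi$ iff $a\in\Pi(\pi)(0)$; negation and disjunction are as usual; $(T,\Pi)\models\mathbf{X}\psi$ iff $(T,\Pi[1])\models\psi$; $(T,\Pi)\models\psi_1\mathbf{U}\psi_2$ iff there is $j\ge 0$ with $(T,\Pi[j])\models\psi_2$ and $(T,\Pi[j'])\models\psi_1$ for all $0\le j'<j$; $(T,\Pi)\models\exists\pi.\varphi$ iff there is $t\in T$ with $(T,\Pi[\pi\mapsto t])\models\varphi$; $(T,\Pi)\models\forall\pi.\varphi$ iff this holds for all $t\in T$. A sentence is a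 formula without free trace variables; $T$ satisfies (is a model of) a sentence $\varphi$ if $(T,\Pi_\emptyset)\models\varphi$ for the empty assignment $\Pi_\emptyset$. A sentence is satisfiable if it has a model. *)

(* Defs.v *)
From mathcomp Require Import all_boot.
From mathcomp Require Import zify.
Set Implicit Arguments.
Unset Strict Implicit.
Unset Printing Implicit Defensive.

Section Traces.
Variable AP : finType.

Definition trace := nat -> {set AP}.

Definition suffix_from (j : nat) (t : trace) : trace := fun n => t (j + n).

(* The trace t0 . t1^omega; the value is meaningful for nonempty t1 only. *)
Definition lasso (t0 t1 : seq {set AP}) : trace :=
  fun n => if n < size t0 then nth set0 t0 n
           else nth set0 t1 ((n - size t0) %% size t1).

Definition ultimately_periodic (t : trace) : Prop :=
  exists t0 t1 : seq {set AP}, [/\ t0 <> [::], t1 <> [::] & t =1 lasso t0 t1].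

Definition ultimately_periodic_set (T : trace -> Prop) : Prop :=
  forall t, T t -> ultimately_periodic t.

Lemma ultimately_periodicP (t : trace) :
  ultimately_periodic t <->
  exists s p, [/\ 0 < s, 0 < p & forall n, s <= n -> t n = t (n + p)].
Proof.
split=> [[t0 [t1 [t0N t1N tE]]]|[s [p [s0 p0 tE]]]].
  exists (size t0), (size t1); split; [by case: t0 t0N {tE}|by case: t1 t1N {tE}|].
  move=> n le_n; rewrite !tE /lasso !ltnNge le_n (leq_trans le_n (leq_addr _ _)) /=.
  by rewrite -addnBAC // modnDr.
exists (mkseq t s), (mkseq (fun i => t (s + i)) p); split.
- by case: s s0 {tE}.
- by case: p p0 {tE}.
move=> n; rewrite /lasso !size_mkseq; case: ltnP => [lt_n|le_n].
  by rewrite nth_mkseq.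
rewrite nth_mkseq ?ltn_mod // -{1}(subnKC le_n) {1}(divn_eq (n - s) p).
elim: (_ %/ p) => [|k IHk]; first by rewrite mul0n.
by rewrite -IHk [in RHS]tE ?leq_addr //; congr t; lia.
Qed.

End Traces.

(* The countable set of trace variables is nat. *)
Definition tvar := nat.

Inductive body (AP : finType) : Type :=
| Atom of AP & tvar
| Not of body AP
| Or of body AP & body AP
| Next of body AP
| Until of body AP & body AP.

Inductive hyperltl (AP : finType) : Type :=
| Exists of tvar & hyperltl AP
| Forall of tvar & hyperltl AP
| Body of body AP.

Section Semantics.
Variable AP : finType.

Fixpoint body_vars (psi : body AP) : seq tvar :=
  match psi with
  | Atom _ x => [:: x]
  | Not psi1 => body_vars psi1
  | Or psi1 psi2 => body_vars psi1 ++ body_vars psi2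
  | Next psi1 => body_vars psi1
  | Until psi1 psi2 => body_vars psi1 ++ body_vars psi2
  end.

Fixpoint free_vars (phi : hyperltl AP) : seq tvar :=
  match phi with
  | Exists x phi1 | Forall x phi1 => [seq y <- free_vars phi1 | y != x]
  | Body psi => body_vars psi
  end.

Definition sentence (phi : hyperltl AP) : Prop := free_vars phi = [::].

Definition assignment := tvar -> option (trace AP).

Definition empty_assignment : assignment := fun=> None.

Definition update (Pi : assignment) (x : tvar) (t : trace AP) : assignment :=
  fun y => if y == x then Some t else Pi y.

Definition shift (j : nat) (Pi : assignment) : assignment :=
  fun x => omap (suffix_from j) (Pi x).

(* Quantifier-free formulas do not depend on the set of traces.  An atom whose
   variable is unassigned is false; this never occurs when a sentence is
   evaluated under the empty assignment. *)
Fixpoint body_sat (Pi : assignment) (psi : body AP) : Prop :=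
  match psi with
  | Atom a x => if Pi x is Some t then a \in t 0 else False
  | Not psi1 => ~ body_sat Pi psi1
  | Or psi1 psi2 => body_sat Pi psi1 \/ body_sat Pi psi2
  | Next psi1 => body_sat (shift 1 Pi) psi1
  | Until psi1 psi2 =>
      exists j, body_sat (shift j Pi) psi2 /\
                forall j', j' < j -> body_sat (shift j' Pi) psi1
  end.

Fixpoint sat (T : trace AP -> Prop) (Pi : assignment) (phi : hyperltl AP) : Prop :=
  match phi with
  | Exists x phi1 => exists t, T t /\ sat T (update Pi x t) phi1
  | Forall x phi1 => forall t, T t -> sat T (update Pi x t) phi1
  | Body psi => body_sat Pi psi
  end.

Definition models (T : trace AP -> Prop) (phi : hyperltl AP) : Prop :=
  sat T empty_assignment phi.

Definition satisfiable (phi : hyperltl AP) : Prop := exists T, models T phi.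

End Semantics.

(* Main.v *)
(* The sentence speaks about traces carrying a counter [b] and a payload [a].
   It asks for a trace with [b] at position 0, for every trace t a trace whose
   counter is that of t shifted right by one and whose payload is that of t
   shifted left by one, and that traces with equal payloads have equal counters.
   The traces t_0, t_1, ... so obtained have pairwise distinct counters, since
   the first [b] of t_n is at position n, while the payload of t_n is the n-th
   suffix of the payload of t_0.  Hence the suffixes of the latter are pairwise
   distinct, so t_0 is not ultimately periodic.  A model is obtained by taking
   the characteristic sequence of the powers of two as payload of t_0. *)
Require Import Defs.
From mathcomp Require Import all_boot.
From mathcomp Require Import zify.
From Stdlib Require Import Classical.
Set Implicit Arguments.
Unset Strict Implicit.
Unset Printing Implicit Defensive.

Section DerivedConnectives.
Variable AP : finType.
Implicit Types (Pi : assignment AP) (p q : body AP).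

Definition And p q := Not (Or (Not p) (Not q)).
Definition Imp p q := Or (Not p) q.
Definition Iff p q := And (Imp p q) (Imp q p).
(* [Or p (Not p)] plays the role of the missing constant true. *)
Definition Always p := Not (Until (Or p (Not p)) (Not p)).

Lemma body_sat_and Pi p q :
  body_sat Pi (And p q) <-> body_sat Pi p /\ body_sat Pi q.
Proof. by move=> /=; tauto. Qed.

Lemma body_sat_imp Pi p q :
  body_sat Pi (Imp p q) <-> (body_sat Pi p -> body_sat Pi q).
Proof. by move=> /=; tauto. Qed.

Lemma body_sat_iff Pi p q :
  body_sat Pi (Iff p q) <-> (body_sat Pi p <-> body_sat Pi q).
Proof. by move=> /=; tauto. Qed.

Lemma body_sat_always Pi p :
  body_sat Pi (Always p) <-> forall j, body_sat (shift j Pi) p.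
Proof.
split=> /= [nU j|Gp [j [np _]]]; last exact: np.
by apply: NNPP => np; apply: nU; exists j; split=> // j' _; apply: classic.
Qed.

End DerivedConnectives.

Local Notation a := true.
Local Notation b := false.

Definition same_atom (c : bool) (x y : tvar) : body bool :=
  Always (Iff (Atom c x) (Atom c y)).

(* [c] on [y] is [c] on [x] without its first letter. *)
Definition tail_atom (c : bool) (x y : tvar) : body bool :=
  Always (Iff (Next (Atom c x)) (Atom c y)).

Definition shifting_body : body bool :=
  And (Atom b 0)
    (And (And (Not (Atom b 3)) (tail_atom b 3 1))
      (And (tail_atom a 1 3)
        (Imp (same_atom a 1 2) (same_atom b 1 2)))).

Definition shifting_sentence : hyperltl bool :=
  Exists 0 (Forall 1 (Forall 2 (Exists 3 (Body shifting_body)))).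

Lemma body_sat_same_atom (Pi : assignment bool) c x y t u :
  Pi x = Some t -> Pi y = Some u ->
  body_sat Pi (same_atom c x y) <-> forall j, (c \in t j) = (c \in u j).
Proof.
move=> Pix Piy; rewrite body_sat_always.
split=> H j; have := H j; rewrite body_sat_iff /= /shift Pix Piy /=
  /suffix_from !addn0; last by move=> ->.
by move=> tu; apply/idP/idP; apply tu.
Qed.

Lemma body_sat_tail_atom (Pi : assignment bool) c x y t u :
  Pi x = Some t -> Pi y = Some u ->
  body_sat Pi (tail_atom c x y) <-> forall j, (c \in t j.+1) = (c \in u j).
Proof.
move=> Pix Piy; rewrite body_sat_always.
split=> H j; have := H j; rewrite body_sat_iff /= /shift Pix Piy /=
  /suffix_from !addn0 addn1; last by move=> ->.
by move=> tu; apply/idP/idP; apply tu.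
Qed.

(** Eliminates assignments once and for all: satisfiability and non-periodicity are both argued on
    this condition. *)
Lemma models_shifting_sentence (T : trace bool -> Prop) :
  models T shifting_sentence <->
  exists t0, [/\ T t0, b \in t0 0 &
    forall t u, T t -> T u ->
    [/\ (forall j, (a \in t j) = (a \in u j)) ->
          forall j, (b \in t j) = (b \in u j) &
      exists v, [/\ T v, b \notin v 0,
        forall j, (b \in v j.+1) = (b \in t j) &
        forall j, (a \in t j.+1) = (a \in v j)]]].
Proof.
have body_satE t0 t u v :
    let Pi := update (update (update (update (@empty_assignment _)
                0 t0) 1 t) 2 u) 3 v in
    body_sat Pi shifting_body <->
    [/\ b \in t0 0, b \notin v 0 &
      [/\ forall j, (b \in v j.+1) = (b \in t j),
          forall j, (a \in t j.+1) = (a \in v j) &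
          (forall j, (a \in t j) = (a \in u j)) ->
          forall j, (b \in t j) = (b \in u j)]].
  move=> Pi; rewrite /shifting_body !body_sat_and body_sat_imp.
  rewrite (@body_sat_tail_atom Pi b 3 1 v t) //.
  rewrite (@body_sat_tail_atom Pi a 1 3 t v) //.
  rewrite (@body_sat_same_atom Pi a 1 2 t u) //.
  rewrite (@body_sat_same_atom Pi b 1 2 t u) //=.
  split=> [[t0b [[/negP vb ?] [? ?]]]|[? /negP vb [? ? ?]]]; do !split=> //.
split=> [[t0 [Tt0 H]]|[t0 [Tt0 t0b H]]]; exists t0.
  have [v0 [_ /body_satE[t0b _ _]]] := H _ Tt0 _ Tt0.
  split=> // t u Tt Tu.
  by have [v [Tv /body_satE[_ ? [? ? ?]]]] := H t Tt u Tu; split=> //; exists v.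
split=> // t Tt u Tu.
have [eq_ab [v [Tv vb bE aE]]] := H t u Tt Tu.
by exists v; split=> //; apply/body_satE.
Qed.

(** The trace [t_n] of the intended model; [if c] separates the payload [a] from the counter [b]. *)
Definition shifting_trace (x : nat -> bool) (n : nat) : trace bool :=
  fun i => [set c : bool | if c then x (n + i) else i == n].

(** Equal payloads force equal indices, hence equal counters; the successor of [t_m] is
    [t_(m+1)]. *)
Lemma shifting_sentence_satisfiable (x : nat -> bool) :
  (forall m n, (forall i, x (m + i) = x (n + i)) -> m = n) ->
  satisfiable shifting_sentence.
Proof.
move=> x_inj; exists (fun t => exists n, t = shifting_trace x n).
apply/models_shifting_sentence; exists (shifting_trace x 0).
split; [by exists 0|by rewrite inE|move=> _ _ [m ->] [n ->]; split].
  move=> eq_a; suff -> : m = n by [].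
  by apply: x_inj => i; have := eq_a i; rewrite !inE.
exists (shifting_trace x m.+1); split; first by exists m.+1.
- by rewrite inE.
- by move=> j; rewrite !inE.
- by move=> j; rewrite !inE addSnnS.
Qed.

Lemma shifting_sentence_not_periodic (T : trace bool -> Prop) :
  ultimately_periodic_set T -> ~ models T shifting_sentence.
Proof.
move=> Tper /models_shifting_sentence[t0 [Tt0 t0b H]].
(* The counter is controlled only up to [n], since that of [t0] is arbitrary after position 0. *)
have tail n : exists t, [/\ T t, forall i, i <= n -> (b \in t i) = (i == n) &
    forall j, (a \in t j) = (a \in t0 (n + j))].
  elim: n => [|n [t [Tt tb ta]]].
    by exists t0; split=> // i; rewrite leqn0 => /eqP->.
  have [_ [v [Tv vb bE aE]]] := H t t Tt Tt.
  exists v; split=> // [[|i] le_in|j]; first exact/negbTE.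
    by rewrite bE tb.
  by rewrite -aE ta addSnnS.
have /ultimately_periodicP[s [p [_ p_gt0 t0E]]] := Tper _ Tt0.
have [t [Tt tb ta]] := tail s; have [u [Tu ub ua]] := tail (s + p).
(* Periodicity equates the payloads of [t] and [u], but at position [s] only [t] carries [b]. *)
have [/(_ _ s)] := H t u Tt Tu.
rewrite tb // ub ?leq_addr // eqxx (_ : s == s + p = false); last by lia.
suff eq_a j : (a \in t j) = (a \in u j) by move=> /(_ eq_a).
by rewrite ta ua t0E ?leq_addr // addnAC.
Qed.

(** For [m < n], index [2 ^ n - m] puts one suffix on a power of two and the other in the gap after
    it. *)
Lemma pow2_suffix_inj (m n : nat) (x := fun i => i == 2 ^ trunc_log 2 i) :
  (forall i, x (m + i) = x (n + i)) -> m = n.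
Proof.
wlog lt_mn : m n / m < n.
  move=> W eq_x; case: (ltngtP m n) => // [lt_mn|lt_nm]; first exact: W.
  by apply/esym/W => // i; rewrite eq_x.
(* Adding [n - m] to [2 ^ n] does not reach the next power of two. *)
have lt_n := @ltn_expl 2 n isT.
move=> /(_ (2 ^ n - m)); rewrite /x subnKC; last by lia.
rewrite trunc_expnK // eqxx (@trunc_log_eq _ n) //; first by lia.
by rewrite expnS; lia.
Qed.

Theorem theorem5 :
  exists (AP : finType) (phi : hyperltl AP),
    [/\ sentence phi, satisfiable phi &
        forall T : trace AP -> Prop,
          ultimately_periodic_set T -> ~ models T phi].
Proof.
exists bool, shifting_sentence; split.
- by [].
- exact: shifting_sentence_satisfiable pow2_suffix_inj.
- exact: shifting_sentence_not_periodic.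
Qed.
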